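(* Fix an integer $h>0$. Call patterns $\alpha,\beta\in S_3$ $h$-Wilf equivalent if $s_n^h(\alpha)=s_n^h(\beta)$ for all $n\ge\max(3,h)$. Then there are exactly three $h$-Wilf equivalence classes of patterns in $S_3$.
   Context: A permutation $\pi=\pi_1\cdots\pi_n$ contains $\alpha\in S_3$ if there are indices $i<j<k$ with $\pi_i\pi_j\pi_k$ order-isomorphic to $\alpha$, and avoids it otherwise. $s_n^h(\alpha)$ is the number of $\alpha$-avoiding permutations of $\{1,\dots,n\}$ with exactly $h$ fixed points (indices $i$ with $\pi_i=i$). *)

(* Defs.v *)
From mathcomp Require Import all_boot all_fingroup.
From mathcomp Require Import boolp.

Set Implicit Arguments.
Unset Strict Implicit.
Unset Printing Implicit Defensive.

(* Permutations of {1, ..., n} are elements of 'S_n, i.e. permutations of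
   'I_n = {0, ..., n-1}; the shift by one preserves both the relative order of
   the values and the fixed points. *)

(* [f] is the increasing choice of positions i_0 < ... < i_(k-1) of the
   occurrence. *)
Definition contains (k n : nat) (alpha : 'S_k) (pi : 'S_n) : bool :=
  [exists f : {ffun 'I_k -> 'I_n},
     [forall a : 'I_k, forall b : 'I_k, (a < b) ==> (f a < f b)] &&
     [forall a : 'I_k, forall b : 'I_k, (pi (f a) < pi (f b)) == (alpha a < alpha b)]].

Definition avoids (k n : nat) (alpha : 'S_k) (pi : 'S_n) : bool :=
  ~~ contains alpha pi.

Definition nb_fixed (n : nat) (pi : 'S_n) : nat := #|[set i | pi i == i]|.

Definition nb_avoiding (n h : nat) (alpha : 'S_3) : nat :=
  #|[set pi : 'S_n | avoids alpha pi & nb_fixed pi == h]|.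

Definition hWilf (h : nat) (alpha beta : 'S_3) : Prop :=
  forall n : nat, maxn 3 h <= n -> nb_avoiding n h alpha = nb_avoiding n h beta.

(* [equivalence_partition] takes a boolean relation, hence [asbool]. *)
Definition hWilf_classes (h : nat) : {set {set 'S_3}} :=
  equivalence_partition (fun alpha beta => `[< hWilf h alpha beta >])
    [set: 'S_3].

(* Main.v *)
Require Import Defs.
From mathcomp Require Import all_boot all_fingroup.
From mathcomp Require Import all_algebra boolp zify ring.

Set Implicit Arguments.
Unset Strict Implicit.
Unset Printing Implicit Defensive.

Import GRing.Theory.

(* The classes are {123}, {132, 213, 321} and {231, 312}. Conjugation by the reversal
   identifies 132 with 213, and inversion identifies 231 with 312, both preserving fixed
   points. For 321 and 132, let F_n be the polynomial sum of q^(number of fixed points)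
   over the avoiders of size n. In both cases
     F_n = C_n + (q - 1) sum_(m < n) C_(n-1-m) F_m,
   where C_n is the number of avoiders (the same for both patterns, by isomorphic
   generating trees). For 321 this comes from splitting at a fixed point. For 132, write
   the permutation as L n R with L above R; the fixed points of the blocks lie on shifted
   diagonals, and the refinement of the identity to the d-th diagonal, in which the sum is
   restricted to m < n - |d|, is proved by induction on n.
   The classes are told apart at n = h (123 against the others, h >= 3), at n = 5
   (the same for h = 1, 2), and at n = h + 2 (231 against 321). *)

(** * Words, pattern avoidance and diagonal counts *)

(* The pattern is encoded by the outcomes of its three comparisons alpha_a < alpha_b. *)
Definition matches (c01 c02 c12 : bool) (x y z : nat) : bool :=
  [&& (x < y) == c01, (x < z) == c02 & (y < z) == c12].

Fixpoint av (c01 c02 c12 : bool) (t : seq nat) : bool :=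
  if t is x :: t' then
    pairwise (fun y z => ~~ matches c01 c02 c12 x y z) t' && av c01 c02 c12 t'
  else true.

Notation av132 := (av true true false).
Notation av321 := (av false false false).

(* Two natural offsets stand for the integer u - v: [diag 0 d] and [diag d 0] count
   the entries on the d-th diagonals on either side of the main one. *)
Fixpoint diag (u v : nat) (t : seq nat) : nat :=
  if t is x :: t' then (x + u == v) + diag u v.+1 t' else 0.

Notation words n := (permutations (iota 0 n)).

Lemma mem_words n t :
  (t \in words n) = [&& uniq t, size t == n & all (gtn n) t].
Proof.
rewrite mem_permutations; apply/idP/and3P => [pt | [Ut /eqP st /allP at_]].
  rewrite (perm_uniq pt) iota_uniq (perm_size pt) size_iota eqxx; split=> //.
  by rewrite (perm_all _ pt); apply/allP => x; rewrite mem_iota.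
apply: uniq_perm => //; first exact: iota_uniq.
have [|//|_ //] := uniq_min_size Ut (s2 := iota 0 n).
  by move=> x /at_; rewrite mem_iota.
by rewrite size_iota st.
Qed.

Lemma size_words n t : t \in words n -> size t = n.
Proof. by rewrite mem_words => /and3P[_ /eqP]. Qed.

Lemma mem_word n t x : t \in words n -> (x \in t) = (x < n).
Proof.
by rewrite mem_permutations => /perm_mem->; rewrite mem_iota.
Qed.

Lemma av_map c01 c02 c12 (f : nat -> nat) t :
  {mono f : x y / x < y} -> av c01 c02 c12 (map f t) = av c01 c02 c12 t.
Proof.
move=> fE; elim: t => //= x t ->; rewrite pairwise_map.
congr (_ && _); apply: eq_pairwise => y z.
by rewrite /= /matches !fE.
Qed.

Lemma av_cat c01 c02 c12 s t :
  av c01 c02 c12 (s ++ t) -> av c01 c02 c12 s && av c01 c02 c12 t.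
Proof.
elim: s => //= x s IHs; rewrite pairwise_cat => /andP[/and3P[_ -> _]].
exact: IHs.
Qed.

Lemma av_mid c01 c02 c12 s y t x z :
  av c01 c02 c12 (s ++ y :: t) -> x \in s -> z \in t ->
  ~~ matches c01 c02 c12 x y z.
Proof.
move=> + + tz; elim: s => //= w s IHs; rewrite pairwise_cat /=.
move=> /andP[/and4P[_ _ /allP yt _] /IHs{}IHs]; rewrite inE.
by case/predU1P => [->|]; [exact: yt | exact: IHs].
Qed.

Lemma diag_cat u v s t : diag u v (s ++ t) = diag u v s + diag u (v + size s) t.
Proof.
by elim: s v => [|x s IHs] v /=; rewrite ?addn0 // IHs addSnnS addnA.
Qed.

Lemma diag_map_add b u v t : diag u v (map (addn b) t) = diag (b + u) v t.
Proof. by elim: t v => //= x t IHt v; rewrite IHt addnCA addnA. Qed.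

Lemma diag_shift k u v t : diag (u + k) (v + k) t = diag u v t.
Proof. by elim: t v => //= x t IHt v; rewrite -addSn IHt addnA eqn_add2r. Qed.

Lemma diag_far_above n u v t : all (gtn n) t -> n + u <= v -> diag u v t = 0.
Proof.
elim: t v => //= x t IHt v /andP[xn tn] uv.
by rewrite IHt ?(ltn_eqF (leq_trans _ uv)) ?ltn_add2r // leqW.
Qed.

Lemma diagE u v t :
  diag u v t = \sum_(0 <= i < size t | nth 0 t i + u == v + i) 1.
Proof.
elim: t v => [|x t IHt] v /=; first by rewrite big_nil.
rewrite big_mkcond big_nat_recl //= addn0 IHt big_mkcond /=; congr (_ + _).
by apply: eq_bigr => i _; rewrite addSnnS.
Qed.

(** Sorting the two factors separately already sorts the whole word, so the sorted factors are an
    initial and a final segment of [iota 0 n]. *)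
Lemma words_split s t n :
  s ++ t \in words n -> allrel ltn s t ->
  s \in words (size s) /\ exists2 r, r \in words (size t) & t = map (addn (size s)) r.
Proof.
rewrite mem_permutations => p_st lt_st.
have n_st : n = size s + size t by rewrite -size_cat (perm_size p_st) size_iota.
have le_st : sorted leq (sort leq s ++ sort leq t).
  rewrite (sorted_pairwise leq_trans) pairwise_cat -!(sorted_pairwise leq_trans).
  rewrite !sort_sorted ?andbT; try exact: leq_total.
  apply/allrelP => x y; rewrite !mem_sort => sx ty.
  by apply: ltnW; apply: (allrelP lt_st).
have eq_st : sort leq s ++ sort leq t = iota 0 n.
  apply: (sorted_eq leq_trans anti_leq le_st (iota_sorted 0 n)).
  by rewrite -(permPr p_st) perm_cat // perm_sort.
have eqs : sort leq s = iota 0 (size s).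
  by rewrite -(take_size_cat (sort leq t) (size_sort leq s)) eq_st n_st iotaD
       take_size_cat ?size_iota.
have eqt : sort leq t = iota (size s) (size t).
  rewrite -(drop_size_cat (sort leq t) (size_sort leq s)) eq_st n_st iotaD.
  by rewrite drop_size_cat ?size_iota.
split; first by rewrite mem_permutations -eqs perm_sym perm_sort.
have pt : perm_eq t (iota (size s) (size t)) by rewrite -eqt perm_sym perm_sort.
exists (map (subn^~ (size s)) t).
  rewrite mem_permutations.
  have <- : map (subn^~ (size s)) (iota (size s) (size t)) = iota 0 (size t).
    rewrite -{2}[size s]addn0 iotaDl -map_comp -[RHS]map_id.
    by apply: eq_map => x /=; rewrite addKn.
  exact: perm_map.
rewrite -map_comp -[LHS]map_id; apply/eq_in_map => x.
by rewrite (perm_mem pt) mem_iota /= => /andP[/subnKC].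
Qed.

(** * Reindexing sums over words *)

(** The common frame of the decompositions at the first entry, at the maximum and at a fixed point:
    [g] is a bijection onto [rT]. Injectivity is asked on members only, because the place where a
    concatenation is cut is known from the sizes of the words. *)
Lemma big_glue (R : Type) (idx : R) (op : Monoid.com_law idx)
    (T U V : eqType) (g : U -> V -> T) (rT : seq T) (rU : seq U) (rV : seq V)
    (G : T -> R) :
  uniq rT -> uniq rU -> uniq rV ->
  {in rU & rV, forall x y, g x y \in rT} ->
  (forall t, t \in rT -> exists x y, [/\ x \in rU, y \in rV & t = g x y]) ->
  (forall x y x' y', g x y = g x' y' ->
     x \in rU -> x' \in rU -> y \in rV -> y' \in rV -> (x, y) = (x', y')) ->
  \big[op/idx]_(t <- rT) G t =
  \big[op/idx]_(x <- rU) \big[op/idx]_(y <- rV) G (g x y).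
Proof.
move=> Ut Uu Uv gT gs g_inj.
transitivity (\big[op/idx]_(t <- [seq g x y | x <- rU, y <- rV]) G t);
  last exact: big_allpairs_dep.
apply: perm_big; apply: uniq_perm => //.
  apply: allpairs_uniq => // -[x y] [x' y'] /allpairsP[[? ?] [? ? [-> ->]]].
  by move=> /allpairsP[[? ?] [? ? [-> ->]]] /= /g_inj->.
move=> t; apply/idP/allpairsP => [/gs[x [y [? ? ->]]]|[[x y] [? ? ->]]].
  by exists (x, y).
exact: gT.
Qed.

Lemma words_uniq n : uniq (words n). Proof. exact: permutations_uniq. Qed.

(** [bump v] makes room for the new value [v] by raising the values from [v] on. *)
Lemma cons_words n v (r : seq nat) :
  (v :: map (bump v) r \in words n.+1) = (v < n.+1) && (r \in words n).
Proof.
rewrite !mem_words /= size_map (map_inj_uniq (can_inj (bumpK v))) eqSS all_map.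
have -> : v \notin map (bump v) r.
  by apply/mapP => -[x _ vx]; have := neq_bump v x; rewrite -vx eqxx.
case: ltnP => vn; last by rewrite !andbF.
rewrite (eq_all (a2 := gtn n)) // => x /=; rewrite /bump.
by case: (leqP v x) => /=; lia.
Qed.

Lemma big_words_cons (R : Type) (idx : R) (op : Monoid.com_law idx) n
    (G : seq nat -> R) :
  \big[op/idx]_(t <- words n.+1) G t =
  \big[op/idx]_(0 <= v < n.+1) \big[op/idx]_(r <- words n) G (v :: map (bump v) r).
Proof.
apply: big_glue; rewrite ?words_uniq ?iota_uniq //.
- by move=> v r; rewrite mem_index_iota cons_words => /= -> ->.
- case=> [|v s vs]; first by move/size_words.
  have [r def_s] : exists r, s = map (bump v) r.
    exists (map (unbump v) s); rewrite -map_comp -[LHS]map_id.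
    apply/eq_in_map => x sx /=; rewrite unbumpK // inE.
    move: vs; rewrite mem_words /= => /andP[/andP[+ _] _].
    by apply: contra => /eqP<-.
  move: vs; rewrite def_s cons_words => /andP[vn rn].
  by exists v, r; rewrite mem_index_iota.
move=> v r v' r' [<- /(inj_map (can_inj (bumpK v))) <- //].
Qed.

(** * Decomposition of 132-avoiders at the maximum *)

Lemma matches132N x y z :
  ~~ matches true true false x y z = [|| y <= x, z <= x | y < z].
Proof.
by rewrite /matches ?(leqNgt y x) ?(leqNgt z x); do 3!case: (_ < _).
Qed.

Lemma matches321N x y z :
  ~~ matches false false false x y z = [|| x < y, x < z | y < z].
Proof.
by rewrite /matches ?(leqNgt y x) ?(leqNgt z x); do 3!case: (_ < _).
Qed.

Lemma pairwise_in (T : eqType) (e : rel T) (s : seq T) :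
  {in s &, forall x y, e x y} -> pairwise e s.
Proof.
elim: s => //= x s IHs es; rewrite IHs => [|y z sy sz]; last first.
  by apply: es; rewrite inE (sy, sz) orbT.
by rewrite andbT; apply/allP => y sy; apply: es; rewrite inE ?eqxx ?sy ?orbT.
Qed.

(** A triple not inside one block ends at the maximum or in the low block [r]; in the latter case
    its last entry lies below its first. Neither is a 132. *)
Lemma av132_glue n a (l r : seq nat) : a <= n ->
    l \in words a -> r \in words (n - a) -> av132 l -> av132 r ->
  av132 (map (addn (n - a)) l ++ n :: r).
Proof.
move=> an la rb avl avr.
have mapE : {mono addn (n - a) : x y / x < y} by move=> x y; rewrite ltn_add2l.
rewrite -(av_map _ _ _ _ mapE) in avl; move: avl.
have: all (fun x => n - a <= x < n) (map (addn (n - a)) l).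
  by rewrite all_map; apply/allP => x; rewrite (mem_word _ la) /=; lia.
elim: (map _ l) => [_ _ | x s IHs] /=.
  rewrite avr andbT; apply: pairwise_in => y z.
  by rewrite !(mem_word _ rb) matches132N; lia.
move=> /andP[/andP[bx xn] alls] /andP[pw /IHs->] //; rewrite andbT.
rewrite pairwise_cat pw /=; apply/and3P; split.
- apply/allrelP => y z sy; rewrite inE matches132N => /predU1P[->|].
    by have := allP alls _ sy => /=; lia.
  by rewrite (mem_word _ rb); lia.
- by apply/allP => z; rewrite (mem_word _ rb) matches132N; lia.
by apply: pairwise_in => y z; rewrite !(mem_word _ rb) matches132N; lia.
Qed.

Lemma glue132_words n a (l r : seq nat) : a <= n -> l \in words a -> r \in words (n - a) ->
  map (addn (n - a)) l ++ n :: r \in words n.+1.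
Proof.
move=> an la rb; have := la; have := rb; rewrite !mem_words.
move=> /and3P[Ur /eqP szr _] /and3P[Ul /eqP szl _].
rewrite cat_uniq /= (map_inj_uniq (@addnI _)) Ul Ur all_cat all_map /=.
rewrite size_cat size_map /= szl szr (mem_word _ rb) -leqNgt leq_subr ltnSn /=.
rewrite !andbT; apply/and4P; split.
- rewrite negb_or; apply/andP; split.
    by apply/mapP => -[x]; rewrite (mem_word _ la); lia.
  by apply/hasPn => x; rewrite (mem_word _ rb) => xb; apply/mapP => -[y]; lia.
- by lia.
- by apply/allP => x; rewrite (mem_word _ la) /=; lia.
- by apply/allP => x; rewrite (mem_word _ rb) /=; lia.
Qed.

Lemma big_av132_at (R : Type) (idx : R) (op : Monoid.com_law idx) n a
    (G : seq nat -> R) : a <= n ->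
  \big[op/idx]_(t <- words n.+1 | av132 t && (index n t == a)) G t =
  \big[op/idx]_(l <- words a | av132 l) \big[op/idx]_(r <- words (n - a) | av132 r)
    G (map (addn (n - a)) l ++ n :: r).
Proof.
move=> an; under [RHS]eq_bigr do rewrite -big_filter.
rewrite -big_filter -[RHS]big_filter; apply: big_glue; rewrite ?filter_uniq ?words_uniq //.
- move=> l r; rewrite !mem_filter => /andP[avl la] /andP[avr rb].
  rewrite av132_glue // glue132_words // andbT /= index_cat /= eqxx addn0 size_map.
  rewrite (size_words la); case: ifP => // /mapP[x].
  by rewrite (mem_word _ la); lia.
- move=> t; rewrite mem_filter => /andP[/andP[avt /eqP ia] tn].
  have tn_n : n \in t by rewrite (mem_word _ tn).
  have [Ut szt _] := and3P (etrans (esym (mem_words _ _)) tn).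
  have sza : a < size t by rewrite -ia index_mem.
  have def_t : t = take a t ++ n :: drop a.+1 t.
    by rewrite -[LHS](cat_take_drop a) (drop_nth 0) // -{2}ia nth_index.
  move: (take a t) (drop a.+1 t) (size_takel (ltnW sza)) def_t => L r szL def_t.
  (* An entry before the maximum and a larger one after it would form a 132 with the maximum in the
     middle. *)
  subst t; have lt_rL : allrel ltn r L.
    apply/allrelP => z x rz Lx /=.
    have := av_mid avt Lx rz; rewrite matches132N.
    have xn : x < n.+1 by rewrite -(mem_word _ tn) mem_cat Lx.
    have zn : z < n.+1 by rewrite -(mem_word _ tn) mem_cat inE rz !orbT.
    have x_n : x != n.
      by apply/eqP => ?; subst x; move: Ut; rewrite cat_uniq /= Lx /= andbF.
    have z_n : z != n.
      by apply/eqP => ?; subst z; move: Ut; rewrite cat_uniq /= rz /= !andbF.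
    have xz : x != z.
      apply/eqP => ?; subst z; move: Ut; rewrite cat_uniq /= => /and3P[_ + _].
      by rewrite negb_or => /andP[_ /hasPn/(_ _ rz)] /=; rewrite Lx.
    by move: xn zn x_n z_n xz; lia.
  have szr : size r = n - a by move: szt; rewrite size_cat /= szL => /eqP; lia.
  (* Deleting the maximum and exchanging the blocks puts the low one first, as [words_split]
     requires. *)
  have rLn : r ++ L \in words n.
    move: tn; rewrite !mem_permutations -[X in iota 0 X]addn1 iotaD add0n /=.
    rewrite perm_sym (perm_catl _ (t2 := [:: n])) // perm_sym.
    by rewrite perm_catC /= cats1 perm_sym perm_rcons perm_sym perm_cons.
  have [] := words_split rLn lt_rL; rewrite szr => rb [l]; rewrite szL => la def_L.
  have := av_cat avt => /andP[avL /=/andP[_ avr]].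
  exists l, r; rewrite !mem_filter la rb avr -def_L; split=> //.
  by move: avL; rewrite def_L av_map => [->|x y] //; rewrite ltn_add2l.
move=> l r l' r' /eqP; rewrite !mem_filter => + /andP[_ la] /andP[_ l'a] _ _.
rewrite eqseq_cat ?size_map ?(size_words la) ?(size_words l'a) //.
by move=> /andP[/eqP/(inj_map (@addnI _))-> /eqP[->]].
Qed.

Lemma big_av132 (R : Type) (idx : R) (op : Monoid.com_law idx) n
    (G : seq nat -> R) :
  \big[op/idx]_(t <- words n.+1 | av132 t) G t =
  \big[op/idx]_(a < n.+1)
    \big[op/idx]_(l <- words a | av132 l) \big[op/idx]_(r <- words (n - a) | av132 r)
      G (map (addn (n - a)) l ++ n :: r).
Proof.
rewrite big_seq_cond.
(* The maximum of a word of size [n.+1] has an index below [n.+1], so [inord] returns that index and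
   not its default. *)
rewrite (partition_big (fun t => inord (index n t) : 'I_n.+1) xpredT) //.
apply: eq_bigr => a _; have an : a <= n by rewrite -ltnS.
rewrite -(big_av132_at _ _ an) [RHS]big_seq_cond; apply: eq_bigl => t.
case tn : (t \in words n.+1); rewrite ?andTb //; congr (_ && _).
rewrite -val_eqE /= inordK // -(size_words tn) index_mem.
by rewrite (mem_word _ tn).
Qed.

(** * Splitting 321-avoiders at a fixed point *)

Lemma glue321_words n i (l r : seq nat) : i <= n -> l \in words i ->
  r \in words (n - i) -> l ++ i :: map (addn i.+1) r \in words n.+1.
Proof.
move=> lin li rb; have := li; have := rb; rewrite !mem_words.
move=> /and3P[Ur /eqP szr _] /and3P[Ul /eqP szl _].
rewrite cat_uniq /= (map_inj_uniq (@addnI _)) Ul Ur all_cat /= all_map /=.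
rewrite size_cat /= size_map szl szr (mem_word _ li) ltnn /= !andbT.
rewrite -andbA ltnS lin /=; apply/and5P; split.
- by apply/hasPn => x /mapP[y _ ->]; rewrite (mem_word _ li); lia.
- by apply/mapP => -[x]; lia.
- by lia.
- by apply/allP => x; rewrite (mem_word _ li) /=; lia.
by apply/allP => x; rewrite (mem_word _ rb) /=; lia.
Qed.

Lemma av321_glue n i (l r : seq nat) : i <= n ->
    l \in words i -> r \in words (n - i) -> av321 l -> av321 r ->
  av321 (l ++ i :: map (addn i.+1) r).
Proof.
move=> lin li rb avl avr.
have all_r : all (ltn i) (map (addn i.+1) r).
  by rewrite all_map; apply/allP => x _ /=; lia.
have mapE : {mono addn i.+1 : x y / x < y} by move=> x y; rewrite ltn_add2l.
rewrite -(av_map _ _ _ _ mapE) in avr.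
move: (map _ r) avr all_r => {mapE rb}s avs /allP s_gt.
have: all (gtn i) l by apply/allP => x; rewrite (mem_word _ li).
elim: l avl {li} => [_ _ | x l IHl] /=.
  by rewrite avs andbT; apply: pairwise_in => y z /s_gt /= iy _; rewrite matches321N iy.
move=> /andP[pw /IHl{}IHl] /andP[x_lt l_lt]; rewrite IHl // andbT.
rewrite pairwise_cat pw /=; apply/and3P; split.
- apply/allrelP => y z _; rewrite inE matches321N => /predU1P[->|/s_gt /=].
    by rewrite x_lt orbT.
  by lia.
- by apply/allP => z; rewrite matches321N x_lt.
by apply: pairwise_in => y z /s_gt /= iy _; rewrite matches321N; lia.
Qed.

Lemma big_av321_fixed (R : Type) (idx : R) (op : Monoid.com_law idx) n i
    (G : seq nat -> R) : i <= n ->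
  \big[op/idx]_(t <- words n.+1 | av321 t && (nth 0 t i == i)) G t =
  \big[op/idx]_(l <- words i | av321 l) \big[op/idx]_(r <- words (n - i) | av321 r)
    G (l ++ i :: map (addn i.+1) r).
Proof.
move=> lin; under [RHS]eq_bigr do rewrite -big_filter.
rewrite -big_filter -[RHS]big_filter; apply: big_glue; rewrite ?filter_uniq ?words_uniq //.
- move=> l r; rewrite !mem_filter => /andP[avl la] /andP[avr rb].
  rewrite (av321_glue lin) // glue321_words // andbT /=.
  by rewrite nth_cat (size_words la) ltnn subnn.
- move=> t; rewrite mem_filter => /andP[/andP[avt /eqP ti] tn].
  have [Ut szt _] := and3P (etrans (esym (mem_words _ _)) tn).
  have szi : i < size t by rewrite (eqP szt).
  have def_t : t = take i t ++ i :: drop i.+1 t.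
    by rewrite -[LHS](cat_take_drop i) (drop_nth 0) // ti.
  move: (take i t) (drop i.+1 t) (size_takel (ltnW szi)) def_t => L s szL def_t.
  subst t; have UL : uniq L by move: Ut; rewrite cat_uniq => /and3P[].
  have L_i x : x \in L -> x != i.
    by move=> Lx; apply/eqP => ?; subst x; move: Ut; rewrite cat_uniq /= Lx /= andbF.
  have s_i x : x \in s -> x != i.
    by move=> sx; apply/eqP => ?; subst x; move: Ut; rewrite cat_uniq /= sx /= !andbF.
  have Ls x : x \in L -> x \in s -> False.
    move=> Lx sx; move: Ut; rewrite cat_uniq /= negb_or.
    by move=> /and3P[_ /andP[_ /hasPn/(_ _ sx)]]; rewrite /= Lx.
  (* If some entry before position [i] exceeds [i], a smaller value after it would complete a 321,
     so all values below [i] come before. Otherwise the [i] entries before are all below [i]. Either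
     way a size count identifies the two sets. *)
  have memL : iota 0 i =i L.
    have [/hasP[x Lx ix]|/hasPn noL] := boolP (has (ltn i) L).
      have [|| _ //] := uniq_min_size (iota_uniq 0 i) (s2 := L); rewrite ?size_iota ?szL //.
      move=> y; rewrite mem_iota /= => yi; have: y \in L ++ i :: s.
        by rewrite (mem_word _ tn); lia.
      rewrite mem_cat inE (ltn_eqF yi) => /orP[// | /= sy].
      have := av_mid avt Lx sy; rewrite matches321N.
      by move: (ix : i < x) yi; lia.
    have [||_ E] := uniq_min_size UL (s2 := iota 0 i); rewrite ?size_iota ?szL //.
      move=> y Ly; rewrite mem_iota /=.
      by have := noL _ Ly; have := L_i _ Ly; rewrite /=; lia.
  have lt_Ls : allrel ltn L (i :: s).
    apply/allrelP => x z; rewrite -memL mem_iota /= inE => xi.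
    case/predU1P=> [->//|sz]; have := s_i _ sz.
    have: z \notin L by apply/negP => /Ls/(_ sz).
    by rewrite -memL mem_iota /=; lia.
  have [] := words_split tn lt_Ls; rewrite szL => Li [r0] r0_w def_s.
  (* The upper factor still starts with the fixed point, so [r0] starts with 0; a second split
     removes it. *)
  have [r rb def_r] : exists2 r, r \in words (n - i) & s = map (addn i.+1) r.
    case: r0 r0_w def_s => [|x r0] // r0_w [x0 def_s].
    have {}x0 : x = 0 by lia.
    subst x; have := @words_split [:: 0] r0 _ r0_w.
    case=> [|_ [r]].
      apply/allrelP => x y; rewrite inE => /eqP->{x} r0y.
      case: y r0y => // r00; move: r0_w; rewrite mem_words /=.
      by rewrite r00.
    move=> rw def_r0; exists r.
      have <- // : size r0 = n - i.
      by move: (size_words tn); rewrite def_s size_cat /= size_map szL; lia.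
    by rewrite def_s def_r0 -map_comp; apply: eq_map => y /=; lia.
  have /andP[avL /=/andP[_ avs]] := av_cat avt.
  exists L, r; rewrite !mem_filter Li rb avL -def_r; split=> //=.
  by move: avs; rewrite def_r av_map => [->|x y] //; rewrite ltn_add2l.
move=> l r l' r' /eqP; rewrite !mem_filter => + /andP[_ la] /andP[_ l'a] _ _.
rewrite eqseq_cat ?(size_words la) ?(size_words l'a) //.
by move=> /andP[/eqP-> /eqP[/(inj_map (@addnI _))->]].
Qed.

(** * Equinumerosity of 132- and 321-avoiders *)

(* The Catalan labels of the generating trees in which the first entry is inserted:
   a new first entry v creates no 132 (resp. 321) in a word exactly when the larger
   (resp. smaller) entries are increasing. *)
Definition inc_above (w : nat) : pred (seq nat) :=
  pairwise (fun y z => [|| y < w, z < w | y < z]).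

Definition inc_below (w : nat) : pred (seq nat) :=
  pairwise (fun y z => [|| w <= y, w <= z | y < z]).

Lemma eq_pairwise1 (T : Type) (e e' : rel T) : e =2 e' -> pairwise e =1 pairwise e'.
Proof. by move=> ee' s; apply: eq_pairwise. Qed.

(** If [w < v], the value [w] occurs after [v] and spoils the increase. If [v <= w], the later
    entries that are at least [w] come from entries of [r] that are at least [v], and none of them
    is below the new first entry. *)
Lemma av132_inc_cons n v w (r : seq nat) : v <= n -> r \in words n -> w <= n.+1 ->
  av132 (v :: map (bump v) r) && inc_above w (v :: map (bump v) r) =
  (v <= w) && (av132 r && inc_above v r).
Proof.
move=> vn rn wn; rewrite /inc_above /= !pairwise_map.
have bumpE : {mono bump v : x y / x < y}.
  by move=> x y; rewrite /bump; do 2!case: leqP => ? /=; lia.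
rewrite av_map //.
rewrite (eq_pairwise1 (e' := fun y z => [|| y < v, z < v | y < z])); last first.
  by move=> y z /=; rewrite matches132N bumpE /bump; do 2!case: leqP => ? /=; lia.
case: (av132 r); rewrite ?andbF ?andbT //=.
case incv: (pairwise _ r) => /=; last by rewrite andbF.
rewrite andbT.
have [vw|wv] := leqP v w; last first.
  rewrite all_map; apply/negP => /andP[/allP/(_ w) + _] /=.
  by rewrite (mem_word _ rn) /bump /= (leqNgt v w) wv /=; lia.
apply/andP; split.
  rewrite all_map; apply/allP => z _ /=; rewrite /bump.
  by case: leqP => ? /=; lia.
move: incv; apply: sub_pairwise => y z /=; rewrite /bump.
by do 2!case: leqP => ? /=; lia.
Qed.

(** If [w <= v], the new entry is not among those below [w]. If [0 < v < w], the value 0 occurs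
    after [v] and spoils the increase. For [v = 0 < w] all values of [r] rise by one, so the label
    drops by one. *)
Lemma av321_inc_cons n v w (r : seq nat) : v <= n -> r \in words n -> w <= n.+1 ->
  av321 (v :: map (bump v) r) && inc_below w (v :: map (bump v) r) =
  if w <= v then av321 r && inc_below v r
  else (v == 0) && (av321 r && inc_below w.-1 r).
Proof.
move=> vn rn wn; rewrite /inc_below /= !pairwise_map.
have bumpE : {mono bump v : x y / x < y}.
  by move=> x y; rewrite /bump; do 2!case: leqP => ? /=; lia.
rewrite av_map //.
rewrite (eq_pairwise1 (e' := fun y z => [|| v <= y, v <= z | y < z])); last first.
  by move=> y z /=; rewrite matches321N bumpE /bump; do 2!case: leqP => ? /=; lia.
case: (av321 r); rewrite ?andbF ?andFb ?if_same //= ?andbT.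
have [wv|vw] := leqP w v.
  case incv: (pairwise _ r) => //=; apply/andP; split.
    by apply/allP.
  move: incv; apply: sub_pairwise => y z /=; rewrite /bump.
  by do 2!case: leqP => ? /=; lia.
case: v vn bumpE vw => [|v] vn bumpE vw /=.
  rewrite [X in X && _](_ : _ = true) /=; last exact: pairwise_in.
  rewrite (_ : all _ _ = true) /=; last first.
    by rewrite all_map; apply/allP => z _; rewrite /= /bump /= orbT.
  apply: eq_pairwise1 => y z /=; rewrite /bump /=; lia.
apply/negP => /andP[_ /andP[+ _]]; rewrite all_map => /allP/(_ 0).
by rewrite (mem_word _ rn) /= /bump /=; lia.
Qed.

Definition count132 n w := \sum_(t <- words n | av132 t && inc_above w t) 1.
Definition count321 n w := \sum_(t <- words n | av321 t && inc_below w t) 1.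

Lemma count132S n w : w <= n.+1 ->
  count132 n.+1 w = \sum_(0 <= v < n.+1 | v <= w) count132 n v.
Proof.
move=> wn; rewrite /count132 big_mkcond big_words_cons [RHS]big_mkcond.
apply: eq_big_nat => v /andP[_ vn].
rewrite (eq_big_seq (fun r => if (v <= w) && (av132 r && inc_above v r) then 1 else 0)).
  by case: leqP => _; rewrite -?big_mkcond //= big1_eq.
by move=> r rn; rewrite (@av132_inc_cons n).
Qed.

Lemma count321S n w : w <= n.+1 ->
  count321 n.+1 w =
  \sum_(0 <= v < n.+1 | w <= v) count321 n v + (0 < w) * count321 n w.-1.
Proof.
move=> wn; rewrite /count321 big_mkcond big_words_cons [in RHS]big_mkcond.
have -> : (0 < w) * count321 n w.-1 =
    \sum_(0 <= v < n.+1) if ~~ (w <= v) && (v == 0) then count321 n w.-1 else 0.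
  rewrite big_nat_recl // big1 ?addn0 => [|v _]; last by rewrite andbF.
  by case: w {wn} => //= w; rewrite mul1n.
rewrite -big_split; apply: eq_big_nat => v /andP[_ vn].
rewrite (eq_big_seq (fun r => if (if w <= v then av321 r && inc_below v r
  else (v == 0) && (av321 r && inc_below w.-1 r)) then 1 else 0)).
  case: leqP => _ /=; first by rewrite addn0 -big_mkcond.
  by case: (v == 0); rewrite /= ?big1_eq // -big_mkcond.
by move=> r rn; rewrite (@av321_inc_cons n).
Qed.

(** The reflection of labels exchanges the two recurrences: [w <= v] becomes a bound from above, and
    the extra term at [w.-1] becomes the top summand of the other sum. *)
Lemma count321_count132 n w : w <= n -> count321 n w = count132 n (n - w).
Proof.
elim: n w => [|n IHn] w wn.
  by rewrite /count321 /count132 (_ : words 0 = [:: [::]]) // !big_cons !big_nil.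
rewrite count321S // count132S ?leq_subr // [in RHS]big_nat_rev /=.
have -> : (0 < w) * count321 n w.-1 =
    \sum_(0 <= v < n.+1) if v.+1 == w then count132 n (n - v) else 0.
  case: w wn => [|w] wn; first by rewrite mul0n big1.
  rewrite mul1n IHn // -big_mkcond /= big_mkord.
  by rewrite (big_pred1 (Ordinal wn)).
rewrite !(big_mkcond (fun v => _ <= _)) -big_split /=; apply: eq_big_nat => v /andP[_ vn].
rewrite add0n subSS IHn // (_ : (n - v <= n.+1 - w) = (w <= v) || (v.+1 == w)); last by lia.
by case: leqP => [wv|_] //=; rewrite gtn_eqF ?addn0.
Qed.

(** At the labels 0 (below) and [n] (above) the monotonicity conditions are vacuous. *)
Lemma card_av321 n :
  \sum_(t <- words n | av321 t) 1 = \sum_(t <- words n | av132 t) 1.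
Proof.
transitivity (count321 n 0).
  apply: eq_bigl => t; rewrite [inc_below _ _]pairwise_in ?andbT // => y z _ _.
rewrite count321_count132 // subn0 /count132 [LHS]big_seq_cond [RHS]big_seq_cond.
apply: eq_bigl => t.
case tn : (t \in words n) => //=.
rewrite [inc_above _ _]pairwise_in ?andbT // => y z; rewrite !(mem_word _ tn).
by move=> ->.
Qed.

(** * From permutations to words *)

Definition word n (pi : 'S_n) : seq nat := [seq val (pi i) | i <- enum 'I_n].

Lemma size_word n (pi : 'S_n) : size (word pi) = n.
Proof. by rewrite size_map size_enum_ord. Qed.

Lemma nth_word n (pi : 'S_n) (i : 'I_n) : nth 0 (word pi) i = pi i.
Proof. by rewrite (nth_map i) ?size_enum_ord // nth_ord_enum. Qed.

Lemma word_inj n : injective (@word n).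
Proof.
by move=> pi rho eq_w; apply/permP => i; apply: val_inj; rewrite /= -!nth_word eq_w.
Qed.

Lemma word_words n (pi : 'S_n) : word pi \in words n.
Proof.
rewrite mem_words size_word eqxx map_inj_uniq ?enum_uniq /=; last first.
  exact: inj_comp val_inj perm_inj.
by apply/allP => _ /mapP[i _ ->] /=.
Qed.

(** [word] is injective and both sides have n! elements, so it enumerates [words n]. *)
Lemma big_words (R : Type) (idx : R) (op : Monoid.com_law idx) n
    (P : pred (seq nat)) (G : seq nat -> R) :
  \big[op/idx]_(t <- words n | P t) G t =
  \big[op/idx]_(pi : 'S_n | P (word pi)) G (word pi).
Proof.
rewrite -(big_map (@word n) P G); apply: perm_big.
have Uw : uniq (map (@word n) (index_enum 'S_n)).
  by rewrite (map_inj_uniq (@word_inj n)) index_enum_uniq.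
apply: uniq_perm; rewrite ?words_uniq //.
have [||_ eq_w] := uniq_min_size Uw (s2 := words n).
- by move=> _ /mapP[pi _ ->]; exact: word_words.
- rewrite size_permutations ?iota_uniq // size_iota size_map.
  by rewrite [index_enum _]unlock -enumT -cardT card_Sn.
- by move=> t; rewrite eq_w.
Qed.

Lemma avP c01 c02 c12 t :
  reflect (forall i j k, i < j -> j < k -> k < size t ->
             ~~ matches c01 c02 c12 (nth 0 t i) (nth 0 t j) (nth 0 t k))
          (av c01 c02 c12 t).
Proof.
elim: t => [|x t IHt] /=; first by left.
apply: (iffP andP) => [[/(pairwiseP 0) pw /IHt av_t] [|i] [|j] [|k] //= ij jk kt|av_t].
- by apply: pw; rewrite ?inE /=; lia.
- exact: av_t.
split; last by apply/IHt => i j k ij jk kt; apply: (av_t i.+1 j.+1 k.+1).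
by apply/(pairwiseP 0) => j k jt kt jk; apply: (av_t 0 j.+1 k.+1).
Qed.

Definition o0 : 'I_3 := @Ordinal 3 0 isT.
Definition o1 : 'I_3 := @Ordinal 3 1 isT.
Definition o2 : 'I_3 := @Ordinal 3 2 isT.

Lemma ord3P (P : 'I_3 -> Prop) : P o0 -> P o1 -> P o2 -> forall a, P a.
Proof.
move=> P0 P1 P2 [[|[|[|//]]] lt_a].
- by rewrite (_ : Ordinal lt_a = o0) //; apply: val_inj.
- by rewrite (_ : Ordinal lt_a = o1) //; apply: val_inj.
- by rewrite (_ : Ordinal lt_a = o2) //; apply: val_inj.
Qed.

(** Of the nine comparisons three suffice: an entry is never below itself, and by injectivity
    swapping two distinct entries negates the outcome. *)
Lemma containsP n (alpha : 'S_3) (pi : 'S_n) :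
  reflect (exists i j k : 'I_n, [/\ i < j, j < k &
             matches (alpha o0 < alpha o1) (alpha o0 < alpha o2) (alpha o1 < alpha o2)
               (pi i) (pi j) (pi k)])
          (contains alpha pi).
Proof.
apply: (iffP existsP) =>
    [[f /andP[/forallP f_incr /forallP f_alpha]] | [i [j [k [ij jk m]]]]].
  exists (f o0), (f o1), (f o2); split.
  - by have /forallP/(_ o1)/implyP-> := f_incr o0.
  - by have /forallP/(_ o2)/implyP-> := f_incr o1.
  by apply/and3P; split; [have /forallP/(_ o1) := f_alpha o0 |
    have /forallP/(_ o2) := f_alpha o0 | have /forallP/(_ o2) := f_alpha o1].
exists [ffun a : 'I_3 => if val a == 0 then i else if val a == 1 then j else k].
have ik := ltn_trans ij jk.
have pi_neq (x y : 'I_n) : x < y -> (pi y < pi x) = ~~ (pi x < pi y).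
  move=> xy; rewrite -leqNgt ltn_neqAle; apply: andb_idl => _.
  by rewrite (inj_eq val_inj) (inj_eq perm_inj) -val_eqE /= gtn_eqF.
have alpha_neq (x y : 'I_3) : x < y -> (alpha y < alpha x) = ~~ (alpha x < alpha y).
  move=> xy; rewrite -leqNgt ltn_neqAle; apply: andb_idl => _.
  by rewrite (inj_eq val_inj) (inj_eq perm_inj) -val_eqE /= gtn_eqF.
move: m => /and3P[/eqP m01 /eqP m02 /eqP m12].
apply/andP; split; apply/forallP; apply: ord3P; apply/forallP; apply: ord3P;
  rewrite !ffunE /= ?ltnn ?ij ?jk ?ik //.
all: rewrite ?(pi_neq _ _ ij) ?(pi_neq _ _ jk) ?(pi_neq _ _ ik).
all: rewrite ?(alpha_neq o0 o1) ?(alpha_neq o0 o2) ?(alpha_neq o1 o2) //.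
all: by rewrite ?m01 ?m02 ?m12 eqxx.
Qed.

Lemma av_wordP c01 c02 c12 n (pi : 'S_n) :
  reflect (forall i j k : 'I_n, i < j -> j < k ->
             ~~ matches c01 c02 c12 (pi i) (pi j) (pi k))
          (av c01 c02 c12 (word pi)).
Proof.
apply: (iffP (avP _ _ _ _)) => av_pi i j k ij jk => [|kn].
  by rewrite -!(nth_word pi); apply: av_pi; rewrite ?size_word.
rewrite size_word in kn; have jn := ltn_trans jk kn; have in_ := ltn_trans ij jn.
have := av_pi (Ordinal in_) (Ordinal jn) (Ordinal kn) ij jk.
by rewrite -!(nth_word pi).
Qed.

Lemma avoids_word n (alpha : 'S_3) (pi : 'S_n) :
  avoids alpha pi =
  av (alpha o0 < alpha o1) (alpha o0 < alpha o2) (alpha o1 < alpha o2) (word pi).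
Proof.
apply/idP/av_wordP => [/containsP no_occ i j k ij jk | av_pi].
  by apply/negP => m; apply: no_occ; exists i, j, k.
by apply/containsP => -[i [j [k [ij jk]]]]; apply/negP/av_pi.
Qed.

Lemma diag_word n u v (pi : 'S_n) :
  diag u v (word pi) = #|[set i | pi i + u == i + v]|.
Proof.
rewrite diagE size_word big_mkord -sum1_card; apply: eq_bigl => i.
by rewrite inE nth_word addnC (addnC _ v).
Qed.

Definition count_av c01 c02 c12 n h :=
  \sum_(t <- words n | av c01 c02 c12 t && (diag 0 0 t == h)) 1.

Lemma nb_fixed_diag n (pi : 'S_n) : nb_fixed pi = diag 0 0 (word pi).
Proof.
rewrite diag_word; apply: eq_card => i.
by rewrite !inE !addn0 -val_eqE.
Qed.

Lemma nb_avoidingE n h (alpha : 'S_3) :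
  nb_avoiding n h alpha =
  count_av (alpha o0 < alpha o1) (alpha o0 < alpha o2) (alpha o1 < alpha o2) n h.
Proof.
rewrite /nb_avoiding /count_av big_words -sum1_card; apply: eq_bigl => pi.
by rewrite inE avoids_word nb_fixed_diag.
Qed.

(** * Symmetries: reversal and inversion *)

Definition rev_perm n : 'S_n := perm (@rev_ord_inj n).

Lemma rev_permV n : ((rev_perm n)^-1)%g = rev_perm n.
Proof.
by apply/permP => i; apply: (perm_inj (s := rev_perm n)); rewrite permKV !permE rev_ordK.
Qed.

(** Positions and values are both reversed, so each comparison keeps its outcome while the first and
    the last pair trade places. *)
Lemma av_rev_perm c01 c02 c12 n (pi : 'S_n) :
  av c01 c02 c12 (word pi) -> av c12 c02 c01 (word (pi ^ rev_perm n)%g).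
Proof.
move=> /av_wordP av_pi; apply/av_wordP => i j k ij jk.
rewrite /conjg rev_permV !permM !permE.
have := av_pi (rev_ord k) (rev_ord j) (rev_ord i).
have rev_lt (x y : 'I_n) : (rev_ord x < rev_ord y) = (y < x).
  by rewrite /=; have := ltn_ord x; have := ltn_ord y; lia.
rewrite !rev_lt => /(_ jk ij); rewrite /matches !rev_lt.
by rewrite andbC -andbA andbCA andbC -!andbA.
Qed.

Lemma nb_fixedJ n (pi s : 'S_n) : nb_fixed (pi ^ s)%g = nb_fixed pi.
Proof.
rewrite /nb_fixed -!sum1_card (reindex_inj (@perm_inj _ s)); apply: eq_bigl => i.
by rewrite !inE permJ (inj_eq perm_inj).
Qed.

Lemma diag_invg u v n (pi : 'S_n) : diag u v (word pi^-1%g) = diag v u (word pi).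
Proof.
rewrite !diag_word -!sum1_card (reindex_inj (@perm_inj _ pi)); apply: eq_bigl => i.
by rewrite !inE permK eq_sym.
Qed.

Lemma count_av_rev c01 c02 c12 n h :
  count_av c01 c02 c12 n h = count_av c12 c02 c01 n h.
Proof.
rewrite /count_av !big_words (reindex_inj (@conjg_inj _ (rev_perm n))).
apply: eq_bigl => pi; rewrite -!nb_fixed_diag nb_fixedJ; congr (_ && _).
apply/idP/idP => [/av_rev_perm|/av_rev_perm //].
by rewrite -conjgM (_ : rev_perm n * rev_perm n = 1)%g ?conjg1 // -{1}rev_permV mulVg.
Qed.

Lemma count_av_inv c01 c02 c12 d01 d02 d12 n h :
  (forall pi : 'S_n, av c01 c02 c12 (word pi^-1%g) = av d01 d02 d12 (word pi)) ->
  count_av c01 c02 c12 n h = count_av d01 d02 d12 n h.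
Proof.
move=> avV; rewrite /count_av !big_words (reindex_inj (@invg_inj _)).
by apply: eq_bigl => pi; rewrite avV diag_invg.
Qed.

Lemma perm_ltN n (s : 'S_n) (x y : 'I_n) :
  x < y -> (s x < s y) = false -> s y < s x.
Proof.
move=> xy /negbT; rewrite -leqNgt leq_eqVlt => /orP[/eqP/val_inj/perm_inj yx|//].
by rewrite yx ltnn in xy.
Qed.

(** The pattern 132 is an involution: exchanging positions and values turns an occurrence into an
    occurrence, read in the order [i], [k], [j]. *)
Lemma av132_invg n (pi : 'S_n) : av132 (word pi^-1%g) = av132 (word pi).
Proof.
suff imp (rho : 'S_n) : av132 (word rho) -> av132 (word rho^-1%g).
  by apply/idP/idP => /imp //; rewrite invgK.
move=> /av_wordP av_rho; apply/av_wordP => i j k ij jk.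
apply/negP => /and3P[/eqP e01 /eqP e02 /eqP e12].
have := av_rho (rho^-1%g i) (rho^-1%g k) (rho^-1%g j) e02 (perm_ltN jk e12).
by rewrite !permKV /matches ij (ltn_trans ij jk) ltnNge (ltnW jk).
Qed.

Lemma av231_invg n (pi : 'S_n) :
  av true false false (word pi^-1%g) = av false false true (word pi).
Proof.
apply/av_wordP/av_wordP => av_pi i j k ij jk; have ik := ltn_trans ij jk;
  apply/negP => /and3P[/eqP e01 /eqP e02 /eqP e12].
  have := av_pi (pi j) (pi k) (pi i) e12 (perm_ltN ik e02).
  by rewrite !permK /matches jk !ltnNge (ltnW ij) (ltnW ik).
have := av_pi (pi^-1%g k) (pi^-1%g i) (pi^-1%g j) (perm_ltN ik e02) e01.
by rewrite !permKV /matches ij !ltnNge (ltnW jk) (ltnW ik).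
Qed.

Lemma count_av_312 n h : count_av false false true n h = count_av true false false n h.
Proof. by symmetry; apply: count_av_inv; exact: av231_invg. Qed.

(** * Generating functions by entries on a diagonal *)

Section GeneratingFunctions.

Variables (R : comNzRingType) (q : R).

Definition gf132 n u v : R := (\sum_(t <- words n | av132 t) q ^+ diag u v t)%R.
Definition gf321 n : R := (\sum_(t <- words n | av321 t) q ^+ diag 0 0 t)%R.
Definition catalan n : R := (\sum_(t <- words n | av132 t) 1)%R.

Local Open Scope ring_scope.

Lemma catalanS n :
  catalan n.+1 = \sum_(a < n.+1) catalan a * catalan (n - a).
Proof.
rewrite /catalan big_av132; apply: eq_bigr => a _.
rewrite mulr_suml; apply: eq_bigr => l _.
by rewrite mulr_sumr; apply: eq_bigr => r _; rewrite mulr1.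
Qed.

(** The left block is raised by [n - a], which is added to [u]; the right block starts at position
    [a.+1], which is added to [v]; the last factor is the maximum, at position [a]. *)
Lemma gf132S n u v :
  gf132 n.+1 u v =
  \sum_(a < n.+1) gf132 a (n - a + u) v * gf132 (n - a) u (v + a).+1 *
    q ^+ (n - a + u == v)%N.
Proof.
rewrite /gf132 big_av132; apply: eq_bigr => a _.
rewrite -mulrA mulr_suml big_seq_cond [RHS]big_seq_cond.
apply: eq_bigr => l /andP[la _]; rewrite mulr_suml mulr_sumr; apply: eq_bigr => r _.
rewrite diag_cat /= size_map (size_words la) diag_map_add !exprD.
have -> : (n + u == v + a)%N = (n - a + u == v)%N by have := ltn_ord a; lia.
by rewrite [q ^+ (_ == _) * _]mulrC.
Qed.

Lemma gf132C n u v : gf132 n u v = gf132 n v u.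
Proof.
rewrite /gf132 !big_words (reindex_inj (@invg_inj _)).
by apply: eq_big => pi; rewrite ?av132_invg // diag_invg.
Qed.

(** The sum of the two truncated differences is the distance |u - v|. Inversion reflects the
    diagonals, so the sign of the offset is irrelevant. *)
Lemma gf132_dist n u v : gf132 n u v = gf132 n 0 ((u - v) + (v - u))%N.
Proof.
wlog uv : u v / (u <= v)%N.
  by move=> th; case/orP: (leq_total u v) => /th //; rewrite gf132C addnC.
rewrite (_ : u - v = 0)%N ?add0n; last by lia.
by apply: eq_bigr => t _; rewrite -(diag_shift u 0) add0n subnK.
Qed.

Lemma gf132_far n d : (n <= d)%N -> gf132 n 0 d = catalan n.
Proof.
move=> nd; rewrite /gf132 /catalan big_seq_cond [RHS]big_seq_cond.
apply: eq_bigr => t /andP[]; rewrite mem_words => /and3P[_ _ tn] _.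
by rewrite (diag_far_above tn) ?expr0 ?addn0.
Qed.

Lemma big_ord_narrow_to (K N : nat) (P : pred nat) (f : nat -> R) :
  (K <= N)%N -> (forall b, P b -> (b < K)%N) ->
  \sum_(b < N | P b) f b = \sum_(b < K | P b) f b.
Proof.
move=> KN PK; rewrite (big_ord_widen_cond _ P f KN); apply: eq_bigl => b.
by apply/idP/andP => [Pb|[]//]; split; last exact: PK.
Qed.

(* The two sums cut the convolution C_K = sum_b C_b C_(K-1-b) at 2b < K + d, the
   second one read backwards. *)
Lemma catalan_cut K d :
  \sum_(b < K | (b + ((b - d) + (d - b)) < K)%N) catalan b * catalan (K.-1 - b) +
  \sum_(b < K | (b + (b + d).+1 < K)%N) catalan b * catalan (K.-1 - b) +
  (K == d)%:R * catalan K = (d <= K)%N%:R * catalan K.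
Proof.
case: K => [|K].
  by rewrite !big_ord0 !add0r leqn0 eq_sym.
have [Kd|dK] := leqP K.+1 d.
  rewrite !big_pred0 ?add0r => [|b|b]; try by apply/negbTE; lia.
  by rewrite eqn_leq Kd.
rewrite (gtn_eqF dK) mul0r addr0 (ltnW dK) mul1r catalanS.
rewrite [X in _ + X](reindex_inj rev_ord_inj) /=.
rewrite [RHS](bigID (fun b : 'I_K.+1 => (b + ((b - d) + (d - b)) < K.+1)%N)) /=.
congr (_ + _); apply: eq_big => b; first by have := ltn_ord b; lia.
have bK : (b <= K)%N by rewrite -ltnS.
by rewrite subSS subKn // mulrC.
Qed.

(* [(q - 1) * marked N k d] is the excess of [gf132 k 0 d] over [catalan k]; [N >= k] is
   only a common summation bound, needed to exchange sums over varying [k]. *)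
Definition marked N k d :=
  \sum_(m < N | (m + d < k)%N) catalan (k.-1 - m) * gf132 m 0 0.

Lemma marked_widen N k d : (k <= N)%N -> marked N k d = marked k k d.
Proof.
move=> kN; rewrite /marked.
apply: (@big_ord_narrow_to k N (fun m => m + d < k)%N
  (fun m => catalan (k.-1 - m) * gf132 m 0 0)) => // b.
exact/leq_ltn_trans/leq_addr.
Qed.

Lemma marked0 N k d : (k <= d)%N -> marked N k d = 0.
Proof. by move=> kd; apply: big_pred0 => m; apply/negbTE; lia. Qed.

(** The linear part of the recurrence at the maximum: the terms stand for a diagonal meeting the
    left block, the right block, or the maximum itself. After exchanging sums, the coefficient of
    [gf132 m 0 0] is [catalan_cut] with [K = N - m]. *)
Lemma marked_split N d :
  \sum_(a < N.+1) (catalan (N - a) * marked N.+1 a ((N - a - d) + (d - (N - a))) +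
                   catalan a * marked N.+1 (N - a) (d + a).+1 +
                   (N - a == d)%N%:R * catalan (N - a) * gf132 a 0 0) =
  marked N.+1 N.+1 d.
Proof.
rewrite !big_split /= /marked.
under eq_bigr => a _ do rewrite mulr_sumr big_mkcond /=.
under [X in _ + X + _]eq_bigr => a _ do rewrite mulr_sumr big_mkcond /=.
rewrite exchange_big /= [X in _ + X + _]exchange_big /= -!big_split /=.
rewrite [RHS]big_mkcond /=; apply: eq_bigr => m _.
have mN : (m <= N)%N by rewrite -ltnS.
rewrite -!big_mkcond /=.
have -> : (if (m + d < N.+1)%N then catalan (N - m) * gf132 m 0 0 else 0) =
          (d <= N - m)%N%:R * catalan (N - m) * gf132 m 0 0.
  have -> : (m + d < N.+1)%N = (d <= N - m)%N by lia.
  by case: leqP; rewrite ?mul1r ?mul0r.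
rewrite -catalan_cut !mulrDl; congr (_ + _ + _).
  (* Here [b] is the size [N - a] of the right block; in the second sum it is the size [a] of the
     left block. *)
  rewrite mulr_suml (reindex_inj rev_ord_inj) /=.
  rewrite -(@big_ord_narrow_to (N - m) N.+1
    (fun b => b + ((b - d) + (d - b)) < N - m)%N
    (fun b => catalan b * catalan ((N - m).-1 - b) * gf132 m 0 0)); [|lia|move=> b; lia].
  apply: eq_big => b; have := ltn_ord b; first by lia.
  move=> bN _; rewrite subSS subKn // mulrA; congr (_ * catalan _ * _); lia.
rewrite mulr_suml -(@big_ord_narrow_to (N - m) N.+1
    (fun b => b + (b + d).+1 < N - m)%N
    (fun b => catalan b * catalan ((N - m).-1 - b) * gf132 m 0 0)); [|lia|move=> b; lia].
apply: eq_big => b; have := ltn_ord b; first by lia.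
move=> bN _; rewrite mulrA; congr (_ * catalan _ * _); lia.
Qed.

(* In the decomposition of a 132-avoider at its maximum, the diagonal meets at most one
   of the two blocks, so that at least one of the two factors is a Catalan number and
   the recurrence becomes linear. *)
Lemma gf132_marked n d : gf132 n 0 d = catalan n + (q - 1) * marked n n d.
Proof.
elim/ltn_ind: n d => -[|N] IH d.
  by rewrite gf132_far // /marked big_ord0 mulr0 addr0.
have {}IH k e : (k <= N)%N -> gf132 k 0 e = catalan k + (q - 1) * marked N.+1 k e.
  by move=> kN; rewrite marked_widen ?IH // ltnW.
rewrite gf132S catalanS -marked_split mulr_sumr -big_split /=.
apply: eq_bigr => a _; have aN : (a <= N)%N by rewrite -ltnS.
rewrite addn0 gf132_dist.
(* The diagonal through the maximum is the main diagonal of the left block and misses the right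
   block. *)
have [<-|bd] := eqVneq (N - a)%N d.
  rewrite !subnn addn0 expr1 mul1r [gf132 (N - a) _ _]gf132_far
    ?[marked _ (N - a) _]marked0; try lia.
  rewrite (IH a 0 aN); ring.
rewrite expr0 mulr1 mulr0n !mul0r addr0 !IH ?leq_subr //.
have [far|near] := ltnP (d + a).+1 (N - a)%N.
  rewrite [marked _ a _]marked0; [ring|lia].
rewrite [marked _ (N - a) _]marked0 //; ring.
Qed.

(* A fixed point of a 321-avoider splits it as a direct sum, and
   q^f - 1 = (q - 1)(1 + q + ... + q^(f-1)) sums over the fixed points. *)
Lemma gf321_marked n :
  gf321 n = catalan n + (q - 1) * \sum_(m < n) catalan (n.-1 - m) * gf321 m.
Proof.
have card321 k : \sum_(t <- words k | av321 t) 1 = catalan k.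
  by rewrite /catalan !big_const_seq; have := card_av321 k; rewrite !sum1_count => ->.
(* The power at a fixed point [i] counts the fixed points before it, so only the left block of the
   split keeps its weight. *)
have tele t k : (k <= size t)%N ->
    q ^+ diag 0 0 (take k t) =
    1 + (q - 1) * \sum_(i < k) if nth 0%N t i == i then q ^+ diag 0 0 (take i t) else 0.
  elim: k => [|k IHk] kt; first by rewrite take0 big_ord0 mulr0 addr0.
  rewrite big_ord_recr /= (take_nth 0%N) // -cats1 diag_cat /= addn0 add0n.
  rewrite size_takel ?(ltnW kt) // !addn0 exprD mulrDr addrA -IHk ?(ltnW kt) //.
  by case: eqP => _; rewrite ?expr1 ?expr0; ring.
case: n => [|n].
  by rewrite /gf321 /catalan (_ : words 0 = [:: [::]]) // !big_cons !big_nil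
     big_ord0 /=; ring.
rewrite -card321 /gf321 big_seq_cond.
rewrite (eq_bigr (fun t => 1 + (q - 1) *
    \sum_(i < n.+1) if nth 0%N t i == i then q ^+ diag 0 0 (take i t) else 0)); last first.
  by move=> t /andP[tn _]; rewrite -tele ?take_oversize ?(size_words tn).
rewrite -big_seq_cond big_split /=; congr (_ + _); rewrite -mulr_sumr; congr (_ * _).
rewrite exchange_big /=; apply: eq_bigr => i _; have lin : (i <= n)%N by rewrite -ltnS.
rewrite -big_mkcondr /= big_av321_fixed // mulr_sumr.
rewrite big_seq_cond [RHS]big_seq_cond; apply: eq_bigr => l /andP[li _].
rewrite -card321 mulr_suml; apply: eq_bigr => r _.
by rewrite mul1r take_size_cat ?(size_words li).
Qed.

Lemma gf321_gf132 n : gf321 n = gf132 n 0 0.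
Proof.
elim/ltn_ind: n => n IH; rewrite gf321_marked gf132_marked /marked.
congr (_ + _ * _); apply: eq_big => m; first by rewrite addn0 ltn_ord.
by move=> _; rewrite IH.
Qed.

End GeneratingFunctions.

(** Take [q] to be the indeterminate over the integers and compare the coefficients of degree
    [h]. *)
Lemma count_av_321 n h :
  count_av false false false n h = count_av true true false n h.
Proof.
have coefE P : ((\sum_(t <- words n | P t) 'X ^+ diag 0 0 t : {poly int})`_h =
    (\sum_(t <- words n | P t && (diag 0 0 t == h)) 1)%N%:R)%R.
  rewrite coef_sum natr_sum [RHS]big_mkcondr; apply: eq_bigr => t _.
  by rewrite coefXn eq_sym; case: eqP.
have := congr1 (fun p : {poly int} => p`_h)%R (gf321_gf132 ('X : {poly int})%R n).
by rewrite /= !coefE => /eqP; rewrite Num.Theory.eqr_nat => /eqP.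
Qed.

(** * Separating the classes *)

Lemma count_avE c01 c02 c12 n h :
  count_av c01 c02 c12 n h =
  #|[set pi : 'S_n | av c01 c02 c12 (word pi) & nb_fixed pi == h]|.
Proof.
rewrite /count_av big_words -sum1_card; apply: eq_bigl => pi.
by rewrite inE nb_fixed_diag.
Qed.

Lemma nb_fixed1 n : nb_fixed (1%g : 'S_n) = n.
Proof. by rewrite -[RHS]card_ord; apply: eq_card => i; rewrite !inE perm1 eqxx. Qed.

Lemma nb_fixed_full n (pi : 'S_n) : nb_fixed pi = n -> pi = 1%g.
Proof.
move=> fix_n; have fixT : [set i | pi i == i] = setT.
  by apply/eqP; rewrite eqEcard subsetT cardsT card_ord -/(nb_fixed pi) fix_n leqnn.
by apply/permP => i; move/setP/(_ i): fixT; rewrite !inE perm1 => /eqP.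
Qed.

(** Only the identity fixes every point, and 123 is the only pattern of size 3 that it contains. *)
Lemma count_av_full c01 c02 c12 n : 2 < n ->
  (0 < count_av c01 c02 c12 n n) = ~~ [&& c01, c02 & c12].
Proof.
move=> n_gt2; rewrite count_avE card_gt0; apply/set0Pn/idP => [[pi] | nc].
  rewrite inE => /andP[/av_wordP av1 /eqP/nb_fixed_full pi1]; rewrite {}pi1 in av1.
  have n_gt1 := ltnW n_gt2; have n_gt0 := ltnW n_gt1.
  have := av1 (Ordinal n_gt0) (Ordinal n_gt1) (Ordinal n_gt2) isT isT.
  by rewrite !perm1; clear; case: c01; case: c02; case: c12.
exists 1%g; rewrite inE nb_fixed1 eqxx andbT; apply/av_wordP => i j k ij jk.
by rewrite !perm1 /matches ij jk (ltn_trans ij jk).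
Qed.

Lemma nb_fixed_compl n h (pi : 'S_n) :
  n = h.+2 -> (nb_fixed pi == h) = (#|[set i | pi i != i]| == 2).
Proof.
have -> : [set i | pi i != i] = ~: [set i | pi i == i].
  by apply/setP => i; rewrite !inE.
have := cardsC [set i | pi i == i]; rewrite card_ord -/(nb_fixed pi); lia.
Qed.

Lemma card2_eq (T : finType) (A : {set T}) x y z :
  #|A| = 2 -> x \in A -> y \in A -> x != y -> z \in A -> (z == x) || (z == y).
Proof.
move=> A2 xA yA xy zA; have /eqP def_A : [set x; y] == A.
  by rewrite eqEcard subUset !sub1set xA yA A2 cards2 xy.
by move: zA; rewrite -def_A !inE.
Qed.

(** The two moved points are exchanged. A case analysis on which positions [i < j < k] of a 231 are
    moved leaves only [i] fixed and [k] moved, and this yields a 321. *)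
Lemma av321_av231 n (pi : 'S_n) :
  #|[set i | pi i != i]| = 2 -> av321 (word pi) -> av true false false (word pi).
Proof.
set N := [set i | _] => N2 /av_wordP av_pi; apply/av_wordP => i j k ij jk.
apply/negP => /and3P[/eqP ij_lt /eqP ik_ge _].
have ik := ltn_trans ij jk; have ki_lt := perm_ltN ik ik_ge.
have N_perm x : x \in N -> pi x \in N by rewrite !inE (inj_eq perm_inj).
have neq_lt (x y : 'I_n) : x < y -> x != y by rewrite -val_eqE => /ltn_eqF ->.
(* If [k] is fixed, then [i] and [j] are the moved points, but [pi i > k] is neither. *)
have [kN | ] := boolP (k \in N); last first.
  rewrite inE negbK => /eqP k_fix; rewrite k_fix in ki_lt.
  have iN : i \in N by rewrite inE eq_sym neq_lt // (ltn_trans ik).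
  have jN : j \in N by rewrite inE eq_sym neq_lt // (ltn_trans jk) // (ltn_trans ki_lt).
  have := card2_eq N2 iN jN (neq_lt _ _ ij) (N_perm _ iN).
  by rewrite -!val_eqE /=; lia.
(* If [i] and [k] are exchanged, then [j] is fixed and [pi j = j < k = pi i]. *)
have [iN | ] := boolP (i \in N).
  have := card2_eq N2 iN kN (neq_lt _ _ ik) (N_perm _ iN).
  have := iN; rewrite inE => /negbTE-> /= /eqP pi_i.
  have [jN | ] := boolP (j \in N).
    have := card2_eq N2 iN kN (neq_lt _ _ ik) jN.
    by rewrite -!val_eqE /=; lia.
  by rewrite inE negbK => /eqP j_fix; move: ij_lt; rewrite pi_i j_fix; lia.
(* Now [pi k < i < k], and these three positions carry [k], [i], [pi k]. *)
rewrite inE negbK => /eqP i_fix; rewrite i_fix in ki_lt.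
have mN := N_perm _ kN; have mk : pi k != k by move: kN; rewrite inE.
have := card2_eq N2 mN kN mk (N_perm _ mN).
have := mN; rewrite inE => /negbTE -> /= /eqP pi_m.
have := av_pi (pi k) i k ki_lt ik.
by rewrite /matches pi_m i_fix !ltnNge (ltnW ik) (ltnW ki_lt) ltnW // (ltn_trans ki_lt).
Qed.

(* For n = h + 2 these permutations are transpositions, and (0 2) avoids 231 but not
   321. *)
Lemma count_av321_lt231 h : 0 < h ->
  count_av false false false h.+2 h < count_av true false false h.+2 h.
Proof.
case: h => // h _; rewrite !count_avE; apply: proper_card; apply/properP; split.
  apply/subsetP => pi; rewrite !inE => /andP[av_pi fix_pi]; rewrite fix_pi andbT.
  by apply: av321_av231 av_pi; apply/eqP; rewrite -(@nb_fixed_compl _ h.+1).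
pose a : 'I_h.+3 := inord 0; pose b : 'I_h.+3 := inord 1; pose c : 'I_h.+3 := inord 2.
have [va vb vc] : [/\ a = 0 :> nat, b = 1 :> nat & c = 2 :> nat].
  by rewrite /a /b /c !inordK.
have ac : a != c by rewrite -val_eqE /= va vc.
have tE (x : 'I_h.+3) :
    tperm a c x = (if x == 0 :> nat then 2 else if x == 2 :> nat then 0 else x) :> nat.
  rewrite -vc -va !val_eqE; case: tpermP => [->|->|/eqP/negbTE-> /eqP/negbTE->] //.
    by rewrite eqxx.
  by rewrite eq_sym (negbTE ac) eqxx.
exists (tperm a c).
  rewrite inE (@nb_fixed_compl _ h.+1) //; apply/andP; split.
    apply/av_wordP => i j k ij jk; apply/negP => /and3P[].
    rewrite !tE; move: (val i) (val j) (val k) ij jk => x y z xy yz.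
    by case: x xy => [|[|[|x]]]; case: y yz => [|[|[|y]]]; case: z => [|[|[|z]]] //=; lia.
  rewrite (_ : [set _ | _] = [set a; c]) ?cards2 ?ac //.
  apply/setP => x; rewrite !inE -!val_eqE /= tE va vc.
  by case: (val x) => [|[|[|y]]] //=; rewrite eqxx.
rewrite inE; apply/negP => /andP[/av_wordP av_t _].
by have := av_t a b c; rewrite /matches !tE va vb vc => /(_ isT isT).
Qed.

(** The boolean [c02] treats 132 and 231 together. For [h] at most 2 the choice n = h is below the
    bound, so the counts are computed at n = 5. *)
Lemma count_av_123_neq h c02 : 0 < h ->
  exists2 n, maxn 3 h <= n & count_av true true true n h <> count_av true c02 false n h.
Proof.
case: h => [|[|[|h]]] // _;
  try by exists 5 => //; rewrite /count_av !sum1_count; case: c02; vm_compute.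
exists h.+3; first by rewrite geq_max leqnn andbT.
move=> e; have := @count_av_full true true true h.+3 isT.
by rewrite e count_av_full // andbF.
Qed.

Lemma count_av_132_231_neq h : 0 < h ->
  exists2 n, maxn 3 h <= n & count_av true true false n h <> count_av true false false n h.
Proof.
move=> h_gt0; exists h.+2; first by lia.
by have := count_av321_lt231 h_gt0; rewrite count_av_321 => lt e; rewrite e ltnn in lt.
Qed.

(** * Counting the classes *)

(** The value is [o0] on 123, [o1] on 132, 213, 321, and [o2] on 231, 312. *)
Definition wclass (alpha : 'S_3) : 'I_3 :=
  if alpha o0 < alpha o2 then
    if (alpha o0 < alpha o1) && (alpha o1 < alpha o2) then o0 else o1
  else if (alpha o0 < alpha o1) || (alpha o1 < alpha o2) then o2 else o1.

Definition class_count (n h : nat) (k : 'I_3) : nat :=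
  if k == o0 then count_av true true true n h
  else if k == o1 then count_av true true false n h
  else count_av true false false n h.

Lemma nb_avoiding_class n h alpha : nb_avoiding n h alpha = class_count n h (wclass alpha).
Proof.
rewrite nb_avoidingE /wclass /class_count.
case: ltnP => c01; case: ltnP => c02; case: ltnP => c12 //=.
(* Of the eight triples of outcomes, the two cyclic ones come from no permutation; this is the
   first. *)
- by have := leq_trans (ltn_trans c01 c12) c02; rewrite ltnn.
- exact: count_av_rev.
- by have := leq_ltn_trans c12 (leq_ltn_trans c01 c02); rewrite ltnn.
- exact: count_av_312.
- exact: count_av_321.
Qed.

Lemma wclass_surj k : exists alpha, wclass alpha = k.
Proof.
have [n01 n02 n12] : [/\ o0 != o1, o0 != o2 & o1 != o2] by [].
elim/ord3P: k.
- by exists 1%g; rewrite /wclass !perm1.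
- by exists (tperm o1 o2); rewrite /wclass tpermL tpermR tpermD // eq_sym.
(* Products apply the left factor first, so this is 231. *)
exists (tperm o0 o1 * tperm o0 o2)%g; rewrite /wclass !permM tpermL tpermR.
by rewrite (tpermD n02 n12) tpermL tpermR (tpermD n01) // eq_sym.
Qed.

Lemma hWilf_wclass h alpha beta : 0 < h ->
  hWilf h alpha beta <-> wclass alpha = wclass beta.
Proof.
move=> h_gt0; split=> [|eq_c n _]; last by rewrite !nb_avoiding_class eq_c.
rewrite /hWilf => eq_nb.
have {eq_nb} : forall n, maxn 3 h <= n ->
    class_count n h (wclass alpha) = class_count n h (wclass beta).
  by move=> n /eq_nb; rewrite !nb_avoiding_class.
have [n1 le1 ne1] := count_av_123_neq true h_gt0.
have [n2 le2 ne2] := count_av_123_neq false h_gt0.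
have [n3 le3 ne3] := count_av_132_231_neq h_gt0.
move: (wclass alpha) (wclass beta); apply: ord3P; apply: ord3P => // E.
- by case: ne1; exact: (E _ le1).
- by case: ne2; exact: (E _ le2).
- by case: ne1; exact: (esym (E _ le1)).
- by case: ne3; exact: (E _ le3).
- by case: ne2; exact: (esym (E _ le2)).
- by case: ne3; exact: (esym (E _ le3)).
Qed.

Theorem theorem6p3 (h : nat) (h_gt0 : 0 < h) : #|hWilf_classes h| = 3.
Proof.
(* The equivalence classes are the fibres of [wclass]; surjectivity makes them nonempty, hence
   distinct. *)
pose fiber k := [set beta | wclass beta == k].
have -> : hWilf_classes h = fiber @: [set: 'I_3].
  have <- : wclass @: [set: 'S_3] = [set: 'I_3].
    apply/setP => k; rewrite inE; have [alpha <-] := wclass_surj k.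
    exact: imset_f.
  rewrite -imset_comp; apply: eq_imset => alpha; apply/setP => beta; rewrite !inE /=.
  by apply/asboolP/eqP => [/(hWilf_wclass _ _ h_gt0)|eq_c]; last exact/hWilf_wclass.
rewrite card_imset ?cardsT ?card_ord // => k l; have [alpha <-] := wclass_surj k.
by move/setP/(_ alpha); rewrite !inE eqxx => /esym/eqP.
Qed.
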